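(* Let $G$ be a finite non-abelian $Cpo$-group and let $p$ be the largest prime divisor of $|G|$. Then $|Cent(G)|=p+2$.
   Context: A finite group $G$ is called a $Cpo$-group if for every non-trivial element $x\in G$ the order of the centralizer $C_G(x)$ is a prime number. For a group $G$, $Cent(G)=\{C_G(x)\mid x\in G\}$ denotes the set of all element centralizers of $G$. *)

(* Defs.v *)
From mathcomp Require Import all_boot all_fingroup.

Set Implicit Arguments.
Unset Strict Implicit.
Unset Printing Implicit Defensive.

Local Open Scope group_scope.

Definition Cpo_group (gT : finGroupType) (G : {group gT}) : Prop :=
  forall x : gT, x \in G -> x != 1 -> prime #|'C_G[x]|.

Definition Cent (gT : finGroupType) (G : {group gT}) : {set {set gT}} :=
  [set 'C_G[x] | x in G].

(* Main.v *)
(** Every Sylow subgroup of a Cpo-group [G] has prime order, because it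
    centralizes a non-trivial element of its own centre; so [#|G|] is
    squarefree.  For a divisor [m] of [#|G|] made of its largest primes,
    Frobenius' theorem on the solutions of [x ^+ m = 1] and a descending
    induction on [m] show that there are exactly [m] solutions; hence the Sylow
    [p]-subgroup [P] for the largest prime [p] is normal.  It is
    self-centralizing, so a complement [Q] embeds in the cyclic group [Aut P];
    being abelian and non-trivial, [Q] has prime order.  The centralizers are
    then [G], [P] and the [p] conjugates of [Q]. *)

Require Import Defs.
From mathcomp Require Import all_boot all_fingroup all_solvable.

Set Implicit Arguments.
Unset Strict Implicit.
Unset Printing Implicit Defensive.

Local Open Scope group_scope.

Lemma dvdn_prime_totient r n : prime r -> 0 < n -> r %| n -> r.-1 %| totient n.
Proof.
move=> r_pr n_gt0 r_n.
rewrite -(partnC r n_gt0) totient_coprime ?coprime_partC // dvdn_mulr //.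
by rewrite p_part totient_pfactor ?dvdn_mulr // -pfactor_dvdn.
Qed.

(** Every element of this set has order divisible by [r]. Sorted by the cyclic subgroup they
    generate, the elements fall into classes of size [totient #[x]], each a multiple of [r.-1]. *)
Lemma dvdn_card_prime_order_multiple (gT : finGroupType) (G : {group gT}) r m :
  prime r -> r.-1 %| #|'Ldiv_(r * m)(G) :\: 'Ldiv_m()|.
Proof.
move=> r_pr; set A := _ :\: _.
have rA x : x \in A -> r %| #[x].
  rewrite !inE -!order_dvdn => /and3P[xm _ xrm]; apply: contraR xm => r_x.
  by rewrite -(Gauss_dvdr m (_ : coprime #[x] r)) // coprime_sym prime_coprime.
rewrite -sum1_card (partition_big_imset (@cycle _)) /=.
apply: dvdn_sum => _ /imsetP[x Ax ->].
(* The class of [x] consists of all generators of [<[x]>]: they have the same order as [x] and also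
   lie in [G], so they belong to [A]. *)
rewrite (eq_bigl (generator <[x]>)) => [|y].
  by rewrite sum1dep_card -totient_gen dvdn_prime_totient ?rA.
rewrite /generator eq_sym andbC; case xy: {+}(_ == _) => //.
move: Ax; rewrite !inE -!order_dvdn -!cycle_subG (eqP xy).
by rewrite -[#[y]]/#|_| -(eqP xy).
Qed.

Lemma card_Ldiv_squarefree (gT : finGroupType) (G : {group gT}) m :
    (forall s, logn s #|G| <= 1) -> m %| #|G| ->
    (forall s t, prime s -> prime t -> s %| m -> t %| #|G| %/ m -> t <= s) ->
  #|'Ldiv_m(G)| = m.
Proof.
(* The induction is on the cofactor [#|G| %/ m], so it starts at [m = #|G|], where every element is
   a solution. *)
move=> sqfG; have [k] := ubnP (#|G| %/ m).
elim: k m => // k IHk m ltGk m_G big_m.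
have m_gt0 : 0 < m by apply: dvdn_gt0 m_G.
have [Gm1 | Gm_gt1] := leqP (#|G| %/ m) 1.
  have Gm : #|G| = m.
    move: Gm1 (cardG_gt0 G); rewrite -{2 3}(divnK m_G).
    by case: (_ %/ m) => [|[]] //=; rewrite mul1n.
  suff -> : 'Ldiv_m(G) = G by [].
  apply/setIidPl/subsetP=> x Gx.
  by rewrite inE -order_dvdn -Gm order_dvdG.
(* Taking the largest prime of the cofactor keeps the hypothesis on prime factors true for
   [r * m]. *)
pose r := max_pdiv (#|G| %/ m).
have r_pr : prime r by rewrite max_pdiv_prime.
have r_Gm : r %| #|G| %/ m by apply: max_pdiv_dvd.
have r_gt1 := prime_gt1 r_pr; have r_gt0 := prime_gt0 r_pr.
have rm_G : r * m %| #|G| by rewrite -(divnK m_G) dvdn_pmul2r.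
have r'm : ~~ (r %| m).
  apply/negP=> r_m; have := sqfG r; rewrite leqNgt => /negP[].
  by rewrite -pfactor_dvdn // (dvdn_trans _ rm_G) // expnS expn1 dvdn_mul.
have rmE : #|G| %/ (r * m) = #|G| %/ m %/ r by rewrite mulnC divnMA.
have cardL : #|'Ldiv_(r * m)(G)| = (r * m)%N.
  apply: IHk => //.
    by rewrite rmE (leq_trans _ (_ : #|G| %/ m <= k)) // ltn_Pdiv // ltnW.
  move=> s t s_pr t_pr s_rm t_Grm.
  have t_Gm : t %| #|G| %/ m.
    by apply: dvdn_trans t_Grm _; rewrite rmE dvdn_div.
  move: s_rm; rewrite Euclid_dvdM // => /orP[|s_m]; last exact: big_m s_m t_Gm.
  rewrite dvdn_prime2 // => /eqP->.
  by apply: max_pdiv_max; rewrite mem_primes t_pr t_Gm (ltnW Gm_gt1).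
have Ldiv_m : 'Ldiv_(r * m)(G) :&: 'Ldiv_m() = 'Ldiv_m(G).
  rewrite -setIA; congr (_ :&: _); apply/setIidPr/subsetP=> x.
  by rewrite !inE -!order_dvdn => /dvdn_mull->.
have := cardsID 'Ldiv_m() 'Ldiv_(r * m)(G).
have := dvdn_card_prime_order_multiple G m r_pr.
rewrite Ldiv_m cardL; set A := _ :\: _ => r1_A.
(* An element of order [r] lies in [A]. This gives [c < r], without which divisibility by [r.-1]
   would yield no bound. *)
have A_gt0 : 0 < #|A|.
  have [|x Gx ox] := Cauchy r_pr (_ : r %| #|G|).
    exact: dvdn_trans (dvdn_mulr _ _) rm_G.
  by apply/card_gt0P; exists x; rewrite !inE Gx -!order_dvdn ox r'm dvdn_mulr.
have [c cardLm] := dvdnP (Frobenius_Ldiv m_G); rewrite cardLm => cardA.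
have c_gt0 : 0 < c.
  have: 0 < #|'Ldiv_m(G)|.
    by apply/card_gt0P; exists 1; rewrite inE group1 inE expg1n /=.
  by rewrite cardLm muln_gt0 => /andP[].
(* [r - 1] divides [#|A| = (r - c) * m] and is prime to [m], all of whose prime
   factors are at least [r]; so [r - 1 <= r - c]. *)
suff -> : c = 1%N by rewrite mul1n.
have {}cardA : #|A| = ((r - c) * m)%N by rewrite mulnBl -cardA addKn.
have r1_m : coprime r.-1 m.
  apply: contraT => ncop; have g_gt0 : 0 < gcdn r.-1 m.
    by rewrite gcdn_gt0 m_gt0 orbT.
  have g_gt1 : 1 < gcdn r.-1 m by rewrite ltn_neqAle eq_sym ncop g_gt0.
  have s_pr := pdiv_prime g_gt1; have := pdiv_dvd (gcdn r.-1 m).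
  rewrite dvdn_gcd => /andP[s_r1 s_m].
  have := big_m _ _ s_pr r_pr s_m r_Gm; rewrite leqNgt => /negP[].
  by rewrite -(prednK r_gt0) ltnS dvdn_leq // -subn1 subn_gt0.
move: A_gt0 r1_A; rewrite cardA muln_gt0 => /andP[rc_gt0 _].
rewrite Gauss_dvdl // => /(dvdn_leq rc_gt0).
have le_cr : c <= r by rewrite ltnW // -subn_gt0.
by rewrite -subn1 leq_sub2lE // => c_le1; apply/eqP; rewrite eqn_leq c_le1.
Qed.

Lemma card_squarefree_Sylow (gT : finGroupType) (G P : {group gT}) p :
    logn p #|G| <= 1 -> prime p -> p %| #|G| -> p.-Sylow(G) P -> #|P| = p.
Proof.
move=> sqfG p_pr p_G sylP.
rewrite (card_Hall sylP) p_part (_ : logn p #|G| = 1)%N //.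
by apply/eqP; rewrite eqn_leq sqfG -pfactor_dvdn ?expn1.
Qed.

(** The count for [m = p] leaves room for no solution of [x ^+ p = 1] outside [P], and the solution
    set is stable under conjugation. *)
Lemma squarefree_Sylow_max_normal (gT : finGroupType) (G P : {group gT}) p :
    (forall s, logn s #|G| <= 1) -> prime p -> p %| #|G| ->
    (forall q, prime q -> q %| #|G| -> q <= p) ->
  p.-Sylow(G) P -> P <| G.
Proof.
move=> sqfG p_pr p_G p_max sylP; have sPG := pHall_sub sylP.
have oP := card_squarefree_Sylow (sqfG p) p_pr p_G sylP.
have defP : P :=: 'Ldiv_p(G).
  apply/eqP; rewrite eqEcard oP card_Ldiv_squarefree //.
    rewrite leqnn andbT; apply/subsetP=> x Px.
    by rewrite inE (subsetP sPG) // inE -order_dvdn -oP order_dvdG.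
  move=> s t s_pr t_pr; rewrite dvdn_prime2 // => /eqP-> t_Gp.
  by apply: p_max => //; apply: dvdn_trans t_Gp (dvdn_div _).
rewrite /normal sPG; apply/subsetP=> g Gg; rewrite inE.
apply/subsetP=> _ /imsetP[x Px ->]; move: Px; rewrite {}defP !inE.
by case/andP=> Gx /eqP xp1; rewrite groupJ // -conjXg xp1 conj1g eqxx.
Qed.

Section CpoGroups.

Variables (gT : finGroupType) (G : {group gT}).
Hypothesis G_Cpo : Cpo_group G.

(** [H] is a non-trivial subgroup of ['C_G[x]], which has prime order, so Lagrange's theorem leaves
    only equality. *)
Lemma Cpo_abelian_sub_cent (H : {group gT}) x :
  abelian H -> H \subset G -> x \in H^# -> 'C_G[x] = H.
Proof.
move=> cHH sHG /setD1P[x1 Hx]; have Gx := subsetP sHG x Hx.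
have sHC : H \subset 'C_G[x].
  by rewrite subsetI sHG sub_cent1 (subsetP cHH).
apply/eqP; rewrite eq_sym eqEcard sHC /= dvdn_leq ?cardG_gt0 //.
have := cardSg sHC; have /primeP[_ Cprime] := G_Cpo Gx x1.
move=> /Cprime/orP[/eqP/card1_trivg H1|/eqP-> //].
by rewrite H1 inE (negPf x1) in Hx.
Qed.

Lemma Cpo_abelian_prime (H : {group gT}) :
  abelian H -> H \subset G -> H :!=: 1 -> prime #|H|.
Proof.
move=> cHH sHG /trivgPn[x Hx x1].
rewrite -(@Cpo_abelian_sub_cent H x) // ?inE ?x1 //.
by apply: G_Cpo; rewrite ?(subsetP sHG).
Qed.

Lemma Cpo_pgroup_abelian (s : nat) (H : {group gT}) :
  s.-group H -> H \subset G -> abelian H.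
Proof.
move=> sH sHG; have [-> | ntH] := eqVneq (H : {set gT}) 1.
  exact: abelian1.
have /trivgPn[x /setIP[Hx cHx] x1] : 'Z(H) != 1.
  by rewrite center_nil_eq1 // (pgroup_nil sH).
have sHC : H \subset 'C_G[x] by rewrite subsetI sHG sub_cent1.
apply: abelianS sHC _; apply: cyclic_abelian; apply: prime_cyclic.
by apply: G_Cpo; rewrite ?(subsetP sHG).
Qed.

Lemma Cpo_card_squarefree s : logn s #|G| <= 1.
Proof.
have [S sylS] := Sylow_exists s G.
have sSG := pHall_sub sylS; have sS := pHall_pgroup sylS.
rewrite -(logn_part s) -(card_Hall sylS).
have [-> | ntS] := eqVneq (S : {set gT}) 1; first by rewrite cards1 logn1.
have := Cpo_abelian_prime (Cpo_pgroup_abelian sS sSG) sSG ntS.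
by move=> S_pr; rewrite logn_prime // leq_b1.
Qed.

End CpoGroups.

(** The kernel of the conjugation action of [Q] on [P] is ['C_Q(P)]. *)
Lemma prime_norm_TIcent_abelian (gT : finGroupType) (P Q : {group gT}) :
  prime #|P| -> Q \subset 'N(P) -> 'C_Q(P) = 1 -> abelian Q.
Proof.
move=> P_pr nPQ regQ.
have injf : 'injm (restrm nPQ (conj_aut P)).
  by rewrite ker_restrm ker_conj_aut regQ.
rewrite -(injm_abelian injf) // im_restrm.
exact: abelianS (Aut_conj_aut _ _) (cyclic_abelian (Aut_prime_cyclic P_pr)).
Qed.

Theorem theorem3p1 (gT : finGroupType) (G : {group gT}) (p : nat)
    (G_Cpo : Cpo_group G) (G_nonabelian : ~~ abelian G)
    (p_prime : prime p) (p_dvd : p %| #|G|)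
    (p_max : forall q : nat, prime q -> q %| #|G| -> q <= p) :
  #|Cent G| = p + 2.
Proof.
have sqfG := Cpo_card_squarefree G_Cpo.
have [P sylP] := Sylow_exists p G; have sPG := pHall_sub sylP.
have nsPG := squarefree_Sylow_max_normal sqfG p_prime p_dvd p_max sylP.
have oP := card_squarefree_Sylow (sqfG p) p_prime p_dvd sylP.
have P_pr : prime #|P| by rewrite oP.
have cPP := cyclic_abelian (prime_cyclic P_pr).
have ntP : P :!=: 1 by rewrite -cardG_gt1 prime_gt1.
have /splitsP[Q /complP[tiPQ defG]] :=
  SchurZassenhaus_split (pHall_Hall sylP) nsPG.
have sQG : Q \subset G by rewrite -defG mulG_subr.
have nPQ := subset_trans sQG (normal_norm nsPG).
have [y Py ny1] := trivgPn P ntP.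
have CyP : 'C_G[y] = P.
  by rewrite (Cpo_abelian_sub_cent G_Cpo cPP) // inE Py inE ny1.
have regQ : 'C_Q(P) = 1.
  have: 'C_Q(P) \subset 'C_G[y] by rewrite setISS // -cent_set1 centS ?sub1set.
  by rewrite CyP => sCP; apply/trivgP; rewrite -tiPQ subsetI sCP subsetIl.
have cQQ := prime_norm_TIcent_abelian P_pr nPQ regQ.
have ntQ : Q :!=: 1.
  by apply: contraNneq G_nonabelian => Q1; rewrite -defG Q1 mulg1.
have Q_pr := Cpo_abelian_prime G_Cpo cQQ sQG ntQ.
have oG : #|G| = (p * #|Q|)%N by rewrite -defG TI_cardMg // oP.
set q := #|Q| in Q_pr oG.
(* Otherwise [p ^ 2] would divide [#|G|]. *)
have p'q : q != p.
  apply: contraTneq (sqfG p) => qp; rewrite -ltnNge oG qp.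
  by rewrite lognM ?prime_gt0 // logn_prime // eqxx.
have sylQ : q.-Sylow(G) Q.
  rewrite pHallE sQG oG p_part lognM ?prime_gt0 //.
  by rewrite !logn_prime // eqxx (negPf p'q) add0n expn1 -/q eqxx.
have [z Qz nz1] := trivgPn Q ntQ.
have CzQ : 'C_G[z] = Q.
  by rewrite (Cpo_abelian_sub_cent G_Cpo cQQ) // inE Qz inE nz1.
have regP : 'C_P(Q) = 1.
  have: 'C_P(Q) \subset 'C_G[z] by rewrite setISS // -cent_set1 centS ?sub1set.
  by rewrite CzQ => sCQ; apply/trivgP; rewrite -tiPQ subsetI sCQ subsetIl.
(* By the modular law ['N_G(Q)] is ['N_P(Q) * Q], and by coprimality ['N_P(Q)] equals ['C_P(Q)],
   which is trivial. Hence [Q] has index [p] in [G] and exactly [p] conjugates. *)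
have NQ : 'N_G(Q) = Q.
  rewrite -{1}defG setIC -group_modr ?normG // setIC.
  rewrite coprime_norm_cent ?regP ?mul1g // oP coprime_sym.
  by rewrite prime_coprime // dvdn_prime2.
have cardQG : #|Q :^: G| = p.
  by rewrite card_conjugates NQ -divgS // oG mulnK ?prime_gt0.
have -> : Cent G = (G : {set gT}) |: ((P : {set gT}) |: Q :^: G).
  apply/setP=> C; rewrite !inE; apply/imsetP/or3P.
    case=> x Gx ->; have [-> | nx1] := eqVneq x 1.
      by rewrite cent11T setIT; constructor 1.
    (* A prime order dividing [p * q] is [p] or [q]. In the first case the centralizer lies in the
       normal Sylow subgroup [P]; in the second it is a Sylow [q]-subgroup, hence conjugate to
       [Q]. *)
    have C_pr := G_Cpo x Gx nx1.
    have := cardSg (subsetIl G 'C[x]); rewrite oG Euclid_dvdM //.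
    rewrite !dvdn_prime2 // => /orP[/eqP oC | /eqP oC].
      constructor 2; rewrite eqEcard oP oC leqnn andbT.
      by rewrite (sub_normal_Hall sylP) ?subsetIl // /pgroup oC pnat_id.
    have [|g Gg defC] := Sylow_trans sylQ (_ : q.-Sylow(G) 'C_G[x]).
      by rewrite pHallE subsetIl /= oC -(card_Hall sylQ).
    by constructor 3; apply/imsetP; exists g.
  case=> [/eqP-> | /eqP-> | /imsetP[g Gg ->]].
  - by exists 1; rewrite // cent11T setIT.
  - by exists y; rewrite // (subsetP sPG).
  exists (z ^ g); first by rewrite groupJ // (subsetP sQG).
  rewrite cent1J -{1}(conjGid Gg) -conjIg.
  by rewrite CzQ.
(* The three kinds of centralizers are distinct: the orders [p] and [q] separate [P] from the
   conjugates of [Q], and all of these are abelian, unlike [G]. *)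
have P'QG : (P : {set gT}) \notin Q :^: G.
  apply/imsetP=> -[g _ defP]; case/eqP: p'q.
  by rewrite -oP defP cardJg.
have G'PQG : (G : {set gT}) \notin (P : {set gT}) |: Q :^: G.
  rewrite !inE negb_or; apply/andP; split.
    by apply: contraNneq G_nonabelian => ->.
  apply/imsetP=> -[g _ defG']; case/negP: G_nonabelian.
  by rewrite defG' abelianJ.
by rewrite cardsU1 G'PQG cardsU1 P'QG cardQG addnA addnC.
Qed.
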